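(* Let $\mathcal{M}=(Q,A,b,c,l,u)$ be any convex QP instance, let $K\ge 1$, and let $(x^k,y^k)_{0\le k\le K}$ be the primal-dual sequence generated within $K$ iterations by the PDQP algorithm on $\mathcal{M}$. Then there exists a $K$-layer PDQP-Net, with some parameter assignment $\Theta_{PDQP}$, that on input $\mathcal{M}$ outputs the same iterative solution sequence; that is, its embeddings $(X^k,Y^k)$ and output maps satisfy $g_x(X^k)=x^k$ and $g_y(Y^k)=y^k$ for all $0\le k\le K$.
   Context: **QP instance.** $\mathcal{M}=(Q,A,b,c,l,u)$ encodes $\min_{l\le x\le u}\ \frac12 x^\top Qx+c^\top x$ subject to $Ax\ge b$, with $Q\in\mathbb{R}^{n\times n}$ symmetric positive semidefinite, $c\in\mathbb{R}^n$, $A\in\mathbb{R}^{m\times n}$, $b\in\mathbb{R}^m$, and bounds $l\le u$ whose entries may be $-\infty$ (for $l$) or $+\infty$ (for $u$). **PDQP algorithm.** Given scalar step-size sequences $\beta^k,\eta_k,\theta^k,\tau_k$, start from $x^0=0$, $y^0=0$, $\bar x^0=x^0$ and iterate for $k=0,1,\dots$: $$x_{md}^k=(1-\beta^k)\bar x^k+\beta^k x^k,$$ $$x^{k+1}=\mathrm{Proj}_{[l,u]}\big(x^k-\eta_k(Qx_{md}^k+c-A^\top y^k)\big),$$ $$y^{k+1}=\mathrm{Proj}_{[0,+\infty)}\big(y^k+\tau_k(b-A(\theta^k(x^{k+1}-x^k)+x^{k+1}))\big),$$ $$\bar x^{k+1}=(1-\beta^k)\bar x^k+\beta^k x^{k+1},$$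 where $\mathrm{Proj}$ denotes the componentwise Euclidean projection onto the indicated box. (The algorithm may stop early when an optimality residual is below a tolerance; the sequence considered consists of the iterates generated in $K$ iterations.) **$K$-layer PDQP-Net.** Choose channel widths $d_x,d_y\ge1$. The learnable parameters are scalars $\beta^k,\eta_k,\theta^k,\tau_k$ and matrices $W_{\bar x}^k\in\mathbb{R}^{d_x\times d_x}$, $W_y^k\in\mathbb{R}^{d_y\times d_x}$, $W_\theta^k\in\mathbb{R}^{d_x\times d_y}$ for each layer $k$ (collectively $\Theta$), together with multilayer perceptrons (compositions of affine maps and ReLU activations, a single affine map being allowed) $f_x:\mathbb{R}\to\mathbb{R}^{d_x}$, $f_y:\mathbb{R}\to\mathbb{R}^{d_y}$, $g_x:\mathbb{R}^{d_x}\to\mathbb{R}$, $g_y:\mathbb{R}^{d_y}\to\mathbb{R}$, applied row by row to vectors and matrices. With zero vectors $x^0\in\mathbb{R}^n$, $y^0\in\mathbb{R}^m$, set $X^0=f_x(x^0)\in\mathbb{R}^{n\times d_x}$, $Y^0=f_y(y^0)\in\mathbb{R}^{m\times d_y}$, $\bar X^0=X^0$, and for $k=0,\dots,K-1$: $$X_{md}^k=(1-\beta^k)\bar X^k+\beta^kX^k,$$ $$X^{k+1}=\Pi^X_{[l,u]}\big(X^k-\eta_k(QX_{md}^kW_{\bar x}^k+c\,\mathbf{1}_x^\top-A^\top Y^kW_y^k)\big),$$ $$Y^{k+1}=\Pi^Y_{[0,\infty]}\big(Y^k+\tau_k(b\,\mathbf{1}_y^\top-A(\theta^k(X^{k+1}-X^k)+X^{k+1})W_\theta^k)\big),$$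 $$\bar X^{k+1}=(1-\beta^k)\bar X^k+\beta^kX^{k+1}.$$ Here $\mathbf{1}_x\in\mathbb{R}^{d_x}$, $\mathbf{1}_y\in\mathbb{R}^{d_y}$ are all-ones vectors, and the operators act on each column by $$\Pi^{X}_{[l,u]}(x)=x+\mathcal{I}_l\cdot\mathrm{ReLU}\big(l-(x-\mathcal{I}_u\cdot\mathrm{ReLU}(x-u))\big)\ \text{with the componentwise meaning of clamping to } [l,u],\qquad \Pi^Y_{[0,\infty]}(y)=\mathrm{ReLU}(y),$$ where $\mathcal{I}_l,\mathcal{I}_u$ are binary vectors indicating which variables have finite lower/upper bounds (so a component of $x$ above its finite upper bound is sent to $u_i$, one below its finite lower bound to $l_i$, and otherwise it is unchanged). The network's output after $k$ layers is $(g_x(X^k),g_y(Y^k))$; its final output is $(g_x(X^K),g_y(Y^K))$. *)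

(* Defs.v *)
From mathcomp Require Import all_boot all_order all_algebra.
From mathcomp Require Import boolp classical_sets constructive_ereal reals.

Set Implicit Arguments.
Unset Strict Implicit.
Unset Printing Implicit Defensive.

Import Order.TTheory GRing.Theory Num.Theory.
Local Open Scope classical_set_scope.
Local Open Scope ring_scope.

(* Encodes  min 1/2 x^T Q x + c^T x  s.t.  A x >= b,  l <= x <= u.  Entries of
   [l] are real or -oo, entries of [u] are real or +oo. *)
Record convex_qp (R : realType) (n m : nat) := ConvexQP {
  qpQ : 'M[R]_n;
  qpA : 'M[R]_(m, n);
  qpb : 'cV[R]_m;
  qpc : 'cV[R]_n;
  qpl : 'cV[\bar R]_n;
  qpu : 'cV[\bar R]_n;
  qpQ_sym : qpQ^T = qpQ;
  qpQ_psd : forall x : 'cV[R]_n, 0 <= (x^T *m qpQ *m x) ord0 ord0;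
  qpl_neqy : forall i, qpl i ord0 != +oo%E;
  qpu_neqNy : forall i, qpu i ord0 != -oo%E;
  qp_le_lu : forall i, (qpl i ord0 <= qpu i ord0)%E
}.

Definition extended_itv (R : realType) (l u : \bar R) : set R :=
  [set z : R | (l <= z%:E)%E /\ (z%:E <= u)%E].

(* The point of [S] nearest to [v]; the default value of [xget] is only used
   when there is no nearest point, which cannot happen for a nonempty closed
   interval. *)
Definition proj_set (R : realType) (S : set R) (v : R) : R :=
  xget v [set w : R | S w /\ forall z, S z -> `|v - w| <= `|v - z|].

Definition proj_box (R : realType) (n : nat) (l u : 'cV[\bar R]_n)
    (v : 'cV[R]_n) : 'cV[R]_n :=
  \col_i proj_set (extended_itv (l i ord0) (u i ord0)) (v i ord0).

Record pdqp_state (R : realType) (n m : nat) := PDQPState {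
  it_x : 'cV[R]_n;
  it_y : 'cV[R]_m;
  it_xbar : 'cV[R]_n
}.

Definition pdqp_step (R : realType) (n m : nat) (M : convex_qp R n m)
    (beta eta theta tau : R) (s : pdqp_state R n m) : pdqp_state R n m :=
  let: PDQPState x y xbar := s in
  let xmd := (1 - beta) *: xbar + beta *: x in
  let x' := proj_box (qpl M) (qpu M)
    (x - eta *: (qpQ M *m xmd + qpc M - (qpA M)^T *m y)) in
  let y' := proj_box (const_mx 0%E) (const_mx +oo%E)
    (y + tau *: (qpb M - qpA M *m (theta *: (x' - x) + x'))) in
  PDQPState x' y' ((1 - beta) *: xbar + beta *: x').

Fixpoint pdqp_iter (R : realType) (n m : nat) (M : convex_qp R n m)
    (beta eta theta tau : nat -> R) (k : nat) : pdqp_state R n m :=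
  if k is j.+1 then
    pdqp_step M (beta j) (eta j) (theta j) (tau j)
      (pdqp_iter M beta eta theta tau j)
  else PDQPState 0 0 0.

Definition relu (R : realType) (x : R) : R := Num.max 0 x.

(* Affine maps act on row vectors, x |-> x W + b, and ReLU is applied between
   consecutive affine maps. *)
Inductive mlp (R : realType) : nat -> nat -> Type :=
| MLPAffine p q (W : 'M[R]_(p, q)) (b : 'rV[R]_q) : mlp R p q
| MLPHidden p h q (W : 'M[R]_(p, h)) (b : 'rV[R]_h) (f : mlp R h q) :
    mlp R p q.

Fixpoint mlp_eval (R : realType) (p q : nat) (f : mlp R p q) :
    'rV[R]_p -> 'rV[R]_q :=
  match f in mlp _ p q return 'rV[R]_p -> 'rV[R]_q with
  | MLPAffine _ _ W b => fun x => x *m W + b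
  | MLPHidden _ _ _ W b g => fun x => mlp_eval g (map_mx (@relu R) (x *m W + b))
  end.

Definition mlp_rows (R : realType) (N p q : nat) (f : mlp R p q)
    (X : 'M[R]_(N, p)) : 'M[R]_(N, q) :=
  \matrix_(i < N) mlp_eval f (row i X).

(* z + I_l ReLU(l - z)  with  z = x - I_u ReLU(x - u),  where I_l and I_u
   indicate finiteness of the bounds; [fine] of an infinite bound is a dummy
   value killed by the indicator. *)
Definition relu_clamp (R : realType) (l u : \bar R) (x : R) : R :=
  let z := x - (u \is a fin_num)%:R * relu (x - fine u) in
  z + (l \is a fin_num)%:R * relu (fine l - z).

Definition PiX (R : realType) (n d : nat) (l u : 'cV[\bar R]_n)
    (X : 'M[R]_(n, d)) : 'M[R]_(n, d) :=
  \matrix_(i, j) relu_clamp (l i ord0) (u i ord0) (X i j).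

Definition PiY (R : realType) (m d : nat) (Y : 'M[R]_(m, d)) : 'M[R]_(m, d) :=
  map_mx (@relu R) Y.

Record net_layer (R : realType) (dx dy : nat) := NetLayer {
  ly_beta : R;
  ly_eta : R;
  ly_theta : R;
  ly_tau : R;
  ly_Wxbar : 'M[R]_(dx, dx);
  ly_Wy : 'M[R]_(dy, dx);
  ly_Wtheta : 'M[R]_(dx, dy)
}.

Record pdqp_net (R : realType) (K : nat) := PDQPNet {
  net_dx : nat;
  net_dy : nat;
  net_dx_gt0 : (0 < net_dx)%N;
  net_dy_gt0 : (0 < net_dy)%N;
  net_layers : K.-tuple (net_layer R net_dx net_dy);
  net_fx : mlp R 1 net_dx;
  net_fy : mlp R 1 net_dy;
  net_gx : mlp R net_dx 1;
  net_gy : mlp R net_dy 1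
}.

Record net_state (R : realType) (n m dx dy : nat) := NetState {
  emb_X : 'M[R]_(n, dx);
  emb_Y : 'M[R]_(m, dy);
  emb_Xbar : 'M[R]_(n, dx)
}.

Definition net_step (R : realType) (n m dx dy : nat) (M : convex_qp R n m)
    (s : net_state R n m dx dy) (ly : net_layer R dx dy) :
    net_state R n m dx dy :=
  let: NetState X Y Xbar := s in
  let: NetLayer beta eta theta tau Wxbar Wy Wtheta := ly in
  let Xmd := (1 - beta) *: Xbar + beta *: X in
  let X' := PiX (qpl M) (qpu M)
    (X - eta *: (qpQ M *m Xmd *m Wxbar + qpc M *m (const_mx 1 : 'rV[R]_dx)
                 - (qpA M)^T *m Y *m Wy)) in
  let Y' := PiY
    (Y + tau *: (qpb M *m (const_mx 1 : 'rV[R]_dy)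
                 - qpA M *m (theta *: (X' - X) + X') *m Wtheta)) in
  NetState X' Y' ((1 - beta) *: Xbar + beta *: X').

Definition net_init (R : realType) (n m K : nat) (N : pdqp_net R K) :
    net_state R n m (net_dx N) (net_dy N) :=
  let X0 := mlp_rows (net_fx N) (0 : 'cV[R]_n) in
  let Y0 := mlp_rows (net_fy N) (0 : 'cV[R]_m) in
  NetState X0 Y0 X0.

(* The embeddings after the first [k] layers, for [k <= K]. *)
Definition net_embed (R : realType) (n m K : nat) (N : pdqp_net R K)
    (M : convex_qp R n m) (k : nat) : net_state R n m (net_dx N) (net_dy N) :=
  foldl (net_step M) (net_init n m N) (take k (net_layers N)).

Definition net_out_x (R : realType) (n m K : nat) (N : pdqp_net R K)
    (M : convex_qp R n m) (k : nat) : 'cV[R]_n :=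
  mlp_rows (net_gx N) (emb_X (net_embed N M k)).

Definition net_out_y (R : realType) (n m K : nat) (N : pdqp_net R K)
    (M : convex_qp R n m) (k : nat) : 'cV[R]_m :=
  mlp_rows (net_gy N) (emb_Y (net_embed N M k)).

(* Main.v *)
Require Import Defs.
From mathcomp Require Import all_boot all_order all_algebra.
From mathcomp Require Import boolp classical_sets constructive_ereal reals.
From mathcomp Require Import ring lra.

Set Implicit Arguments.
Unset Strict Implicit.
Unset Printing Implicit Defensive.

Import Order.TTheory GRing.Theory Num.Theory.
Local Open Scope classical_set_scope.
Local Open Scope ring_scope.

(** A layer of the network is a step of the algorithm in which vectors have
    become matrices of channels, the products by Q, A and A^T are followed by
    learnable channel mixings, and the projections are written with ReLU.  With
    one channel and all mixing matrices equal to 1 the affine parts of the two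
    are literally the same, because the all-ones row of width one is the scalar
    1.  What is left is to see that the ReLU expressions compute the metric
    projections ([proj_set_relu_clamp], [proj_set_relu]).  The projections are
    defined by minimality of the distance; the clamped value w of v is
    recognised by the variational inequality (v - w) (z - w) <= 0 for all z in
    the interval, which forces w to be the only nearest point ([proj_set_eq]).

    Taking identity maps for the encoders and decoders, the whole state of the
    network, averaged iterate included, coincides with the state of the
    algorithm, and this is the invariant that goes through the induction on
    layers ([net_embed_unit_net]).  The network depends only on the step sizes
    and on K, so one network serves all instances of all dimensions. *)

(** Expanding the square, |v - z|^2 = |v - w|^2 + |z - w|^2 - 2 (v - w) (z - w),
    so the variational inequality makes every other point of [S] strictly
    farther from [v] than [w]. *)
Lemma proj_set_eq (R : realType) (S : set R) (v w : R) :
  S w -> (forall z, S z -> (v - w) * (z - w) <= 0) -> proj_set S v = w.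
Proof.
move=> Sw varw.
have expand z :
    `|v - z| ^+ 2 = `|v - w| ^+ 2 + (z - w) ^+ 2 - 2 * ((v - w) * (z - w)).
  by rewrite !real_normK ?num_real //; ring.
apply: xget_unique => [|w' [Sw' /(_ w Sw) le_w']].
  split=> // z /varw vz.
  rewrite -ler_sqr ?nnegrE ?normr_ge0 // (expand z).
  by have := sqr_ge0 (z - w); lra.
have {}le_w' : `|v - w'| ^+ 2 <= `|v - w| ^+ 2.
  by rewrite ler_sqr ?nnegrE ?normr_ge0.
apply/eqP; rewrite -subr_eq0 -sqrf_eq0 eq_le sqr_ge0 andbT.
by have := varw w' Sw'; rewrite (expand w') in le_w'; lra.
Qed.

(** The clamped value is [v] itself, or the lower bound when [v] is below the
    interval, or the upper bound when [v] is above it; in each case the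
    variational inequality is a matter of signs.  Since [l <= u], a value that
    the inner correction has moved down to [u] is not moved again by the outer
    one. *)
Lemma proj_set_relu_clamp (R : realType) (l u : \bar R) (v : R) :
    l != +oo%E -> u != -oo%E -> (l <= u)%E ->
  proj_set (extended_itv l u) v = relu_clamp l u v.
Proof.
rewrite /relu_clamp /relu.
(* The infinite bounds of the wrong sign are excluded, which leaves the four
   combinations of finite and missing bounds. *)
case: l u => [l||] [u||] //= _ _; rewrite ?lee_fin ?mul0r ?mul1r => lu;
  apply: proj_set_eq => [|z];
  rewrite /extended_itv /= ?lee_fin ?leNye ?leey /Order.max;
  by [split=> //; do ?case: ifP => ?; lra | case=> ? ?; do ?case: ifP => ?; nra].
Qed.

Lemma proj_set_relu (R : realType) (v : R) :
  proj_set (extended_itv 0%E +oo%E) v = relu v.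
Proof.
rewrite proj_set_relu_clamp ?leey // /relu_clamp /relu /=.
rewrite mul0r mul1r subr0 sub0r /Order.max.
by do ?case: ifP => ?; lra.
Qed.

Definition unit_layer (R : realType) (beta eta theta tau : R) :
    net_layer R 1 1 :=
  NetLayer beta eta theta tau 1%:M 1%:M 1%:M.

Definition id_mlp (R : realType) : mlp R 1 1 := MLPAffine 1%:M 0.

Lemma id_mlpE (R : realType) (N : nat) (X : 'cV[R]_N) :
  mlp_rows (id_mlp R) X = X.
Proof. by apply/row_matrixP => i; rewrite rowK /= mulmx1 addr0. Qed.

Definition unit_net (R : realType) (beta eta theta tau : nat -> R) (K : nat) :
    pdqp_net R K :=
  PDQPNet (ltn0Sn 0) (ltn0Sn 0)
    [tuple unit_layer (beta i) (eta i) (theta i) (tau i) | i < K]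
    (id_mlp R) (id_mlp R) (id_mlp R) (id_mlp R).

Definition net_state_of_pdqp (R : realType) (n m : nat) (s : pdqp_state R n m) :
    net_state R n m 1 1 :=
  NetState (it_x s) (it_y s) (it_xbar s).

Lemma PiX_proj_box (R : realType) (n m : nat) (M : convex_qp R n m)
    (v : 'cV[R]_n) :
  PiX (qpl M) (qpu M) v = proj_box (qpl M) (qpu M) v.
Proof.
apply/colP => i; rewrite !mxE.
by rewrite proj_set_relu_clamp ?qpl_neqy ?qpu_neqNy ?qp_le_lu.
Qed.

Lemma PiY_proj_box (R : realType) (m : nat) (v : 'cV[R]_m) :
  PiY v = proj_box (const_mx 0%E) (const_mx +oo%E) v.
Proof. by apply/colP => i; rewrite !mxE proj_set_relu. Qed.

(** With width one, [M *m X *m 1%:M] is [M *m X] and the all-ones row is [1%:M],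
    so only the two projections separate a layer from a step. *)
Lemma net_step_unit_layer (R : realType) (n m : nat) (M : convex_qp R n m)
    (beta eta theta tau : R) (s : pdqp_state R n m) :
  net_step M (net_state_of_pdqp s) (unit_layer beta eta theta tau) =
  net_state_of_pdqp (pdqp_step M beta eta theta tau s).
Proof.
case: s => x y xbar; rewrite /net_state_of_pdqp /=.
have -> : const_mx 1 = 1%:M :> 'rV[R]_1 by apply/rowP => i; rewrite ord1 !mxE.
by rewrite !mulmx1 PiX_proj_box PiY_proj_box.
Qed.

(** The averaged iterate has to be part of the claim, since the next layer reads
    it. *)
Lemma net_embed_unit_net (R : realType) (n m : nat) (M : convex_qp R n m)
    (beta eta theta tau : nat -> R) (K k : nat) (le_kK : (k <= K)%N) :
  net_embed (unit_net beta eta theta tau K) M k =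
  net_state_of_pdqp (pdqp_iter M beta eta theta tau k).
Proof.
elim: k le_kK => [|k IHk] lt_kK.
  by rewrite /net_embed take0 /net_init /= !id_mlpE.
pose layer0 := unit_layer (0 : R) 0 0 0.
rewrite /net_embed (take_nth layer0) ?size_tuple // foldl_rcons.
rewrite -[foldl _ _ _]/(net_embed _ M k) IHk ?(ltnW lt_kK) //.
by rewrite -(tnth_nth layer0 _ (Ordinal lt_kK)) tnth_mktuple net_step_unit_layer.
Qed.

Theorem theorem3p1 (R : realType) (n m : nat) (M : convex_qp R n m)
  (beta eta theta tau : nat -> R) (K : nat) (hK : (1 <= K)%N) :
  exists N : pdqp_net R K,
    forall k : nat, (k <= K)%N ->
      net_out_x N M k = it_x (pdqp_iter M beta eta theta tau k) /\
      net_out_y N M k = it_y (pdqp_iter M beta eta theta tau k).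
Proof.
exists (unit_net beta eta theta tau K) => k le_kK.
by rewrite /net_out_x /net_out_y net_embed_unit_net // !id_mlpE.
Qed.
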